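(* Let $X$ be a synchronized entropy minimal $\mathbb{Z}$-subshift such that the (unique) measure of maximal entropy of $X$ is mixing. Then $$\lim_{n\to\infty}\frac{|L_n(X)|}{e^{n h_{top}(X)}}\quad\text{exists.}$$
   Context: A $\mathbb{Z}$-subshift is a (nonempty) closed set $X\subseteq\mathcal{A}^{\mathbb{Z}}$ ($\mathcal{A}$ a finite alphabet) invariant under all shifts $(\sigma_n x)_i=x_{i+n}$, $n\in\mathbb{Z}$. $L_n(X)$ is the set of words of length $n$ occurring in points of $X$, $L(X)=\bigcup_{n\ge1} L_n(X)$, and $h_{top}(X)=\lim_n\frac1n\log|L_n(X)|$. A word $v\in L(X)$ is synchronizing if for all words $u,w$ with $uv\in L(X)$ and $vw\in L(X)$ one has $uvw\in L(X)$. $X$ is synchronized if $L(X)$ contains a synchronizing word. $X$ is entropy minimal if every subshift strictly contained in $X$ has strictly lower topological entropy; equivalently, every measure of maximal entropy on $X$ is fully supported. Measures are shift-invariant Borel probability measures; $\mu(w)=\mu(\{x\in X:x_{[0,n)}=w\})$ for a word $w$ of length $n$; $h_\mu(X)=\lim_n\frac1n\sum_{w\in\mathcal{A}^n}-\mu(w)\log\mu(w)$; $\mu$ is a measure of maximal entropy if $h_\mu(X)=h_{top}(X)$. It is known that a synchronized entropy minimal subshift has a unique measure of maximal entropy. A measure $\mu$ is mixing if $\lim_{n\to\infty}\mu(A\cap\sigma_{-n}B)=\mu(A)\mu(B)$ for all measurable $A,B$. *)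

(* Defs.v *)
From HB Require Import structures.
From mathcomp Require Import all_boot all_order all_algebra.
From mathcomp Require Import all_classical all_reals all_analysis.

Set Implicit Arguments.
Unset Strict Implicit.
Unset Printing Implicit Defensive.

Import Order.TTheory GRing.Theory Num.Theory.
Import numFieldNormedType.Exports.

Local Open Scope classical_set_scope.
Local Open Scope ring_scope.

(* The distinguished letter is used only because a [measurableType] must be
   pointed; a nonempty subshift has a nonempty alphabet anyway. *)
#[short(type="alphabetType")]
HB.structure Definition Alphabet := {T of Finite T & Pointed T}.

(* The product topology of the discrete topology, and its Borel sigma-algebra. *)
Definition fullshift (A : alphabetType) : Type :=
  prod_topology (fun _ : int => discrete_topology A).

HB.instance Definition _ (A : alphabetType) :=
  Topological.copy (fullshift A)
    (prod_topology (fun _ : int => discrete_topology A)).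
HB.instance Definition _ (A : alphabetType) :=
  isPointed.Build (fullshift A) (fun _ : int => point : A).
HB.instance Definition _ (A : alphabetType) :=
  Measurable.copy (fullshift A)
    (g_sigma_algebraType (@open (fullshift A))).

Section Subshifts.
Context {A : alphabetType}.
Implicit Types (X Y : set (fullshift A)) (x : fullshift A).

Definition shift (n : int) x : fullshift A := fun i : int => x (i + n).

Definition subshift X :=
  [/\ X !=set0, closed X & forall n : int, shift n @` X `<=` X].

(* The word x_[i, i + n). *)
Definition word x (i : int) (n : nat) : n.-tuple A :=
  [tuple (x (i + k%:Z) : A) | k < n].

Definition words_of_length X (n : nat) : {set n.-tuple A} :=
  [set w | `[< exists x, exists i : int, X x /\ word x i n = w >] ]%SET.

(* The empty word is excluded. *)
Definition language X : set (seq A) :=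
  [set w | (0 < size w)%N /\ in_tuple w \in words_of_length X (size w)].

Definition synchronizing X (v : seq A) :=
  language X v /\
  forall u w : seq A,
    language X (u ++ v) -> language X (v ++ w) -> language X (u ++ v ++ w).

Definition synchronized X := exists v, synchronizing X v.

Section Entropy.
Variable R : realType.

Definition htop X : R :=
  limn (fun n => n%:R^-1 * ln (#|words_of_length X n|%:R : R)).

Definition entropy_minimal X :=
  forall Y, subshift Y -> Y `<` X -> htop Y < htop X.

Implicit Type mu : probability (fullshift A) R.

(* A measure on X is a measure on the full shift giving X full mass. *)
Definition invariant_measure_on X mu :=
  mu X = 1%E /\
  forall (n : int) (B : set (fullshift A)),
    measurable B -> mu (shift n @^-1` B) = mu B.

Definition word_measure X mu (n : nat) (w : n.-tuple A) : R :=
  fine (mu [set x | X x /\ word x 0 n = w]).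

(* [ln 0 = 0], so words of measure zero contribute zero. *)
Definition measure_entropy X mu : R :=
  limn (fun n => n%:R^-1 *
    \sum_(w : n.-tuple A)
      - (word_measure X mu w * ln (word_measure X mu w))).

Definition maximal_entropy_measure X mu :=
  invariant_measure_on X mu /\ measure_entropy X mu = htop X.

Definition mixing mu :=
  forall B C : set (fullshift A), measurable B -> measurable C ->
    (fun n : nat => mu (B `&` shift (- n%:Z) @` C)) @ \oo --> (mu B * mu C)%E.

End Entropy.
End Subshifts.

(* Main.v *)
From mathcomp Require Import all_boot all_order all_algebra.
From mathcomp Require Import all_classical all_reals all_analysis.
From mathcomp Require Import zify ring lra.
Require Import Defs.

(** Write [h] for the topological entropy of [X], fix a synchronizing word [v]
    of length [k], and cut the words of [X] at the occurrences of [v].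

    Because [v] synchronizes, both pieces of a word cut at an occurrence of [v]
    (each of them keeping that occurrence) can be chosen independently.
    Cutting at the first occurrence gives [language_decomp]:
      |L_(n+k)| = d_(n+k) + sum_(i <= n) a_i E_(n-i),
    where [d_n] counts the words of length [n] avoiding [v], while [E_n] and [a_n]
    count words of length [n + k]: those starting with [v], and those in which [v]
    occurs exactly once, at the end.  Cutting a word that
    starts with [v] at the next occurrence gives the renewal equation
    [starting_decomp]:
      E_n = b_n + sum_(1 <= i <= n) r_i E_(n-i),
    where [r_n] counts the first-return words of length [n + k], and [b_n] the
    words of that length in which [v] occurs only at the start.

    Entropy minimality makes [d] negligible: the points of [X] that avoid [v]
    form a strictly smaller subshift, or none at all, and by compactness its
    language controls the words avoiding [v].  Hence [d_M < e^(h M)] for some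
    [M > 0] ([avoiding_subcritical]), and since [d] is submultiplicative the
    sequence [d_n e^(-h n)] is summable; so are the sequences of [a] and [b], which
    are dominated by [d].  It is therefore enough that [E_n e^(-h n)] converges,
    for its convolution with the summable sequence [a_n e^(-h n)] then converges
    too.

    The convergence of [E_n e^(-h n)] is the renewal theorem of Erdos, Feller and
    Pollard ([renewal_cvg]) for the weights [f_i = r_i e^(-h i)].  Their total mass
    is at most 1, for otherwise the exponential growth rate of [E_n] would exceed
    [h] ([renewal_mass_le1]).  Aperiodicity is where the measure enters.  A measure
    of maximal entropy charges [v], since otherwise its entropy would be at most
    the growth rate of [d], below [h] ([sync_word_measure_gt0]); mixing then forces [v] to
    be seen both at 0 and at [n] in some point of [X], for every large [n]
    ([mixing_returns]), and each such [n] is a sum of first-return times. *)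

Set Implicit Arguments.
Unset Strict Implicit.
Unset Printing Implicit Defensive.

Import Order.TTheory GRing.Theory Num.Theory.
Import numFieldNormedType.Exports.

Local Open Scope classical_set_scope.
Local Open Scope ring_scope.

(** * Series and limits *)

Section Analysis.
Variable R : realType.
Implicit Types (u w f g : nat -> R).

Lemma partial_sum_mono f (m n : nat) : (forall i, 0 <= f i) -> (m <= n)%N ->
  \sum_(i < m) f i <= \sum_(i < n) f i.
Proof.
move=> f0 mn; rewrite -!(big_mkord xpredT f).
by rewrite [leRHS](big_cat_nat (n := m)) //= lerDl sumr_ge0.
Qed.

Lemma cvg_nonneg_series f B : (forall i, 0 <= f i) ->
  (forall n, \sum_(i < n) f i <= B) -> cvgn (series f).
Proof.
move=> f0 fB.
have mono : nondecreasing_seq (series f).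
  by move=> m n mn; rewrite seriesEord /=; exact: partial_sum_mono.
have ub : has_ubound (range (series f)).
  by exists B => _ [n _ <-]; rewrite seriesEord /= fB.
exact: nondecreasing_is_cvgn mono ub.
Qed.

Lemma series_le_lim f n : (forall i, 0 <= f i) -> cvgn (series f) ->
  \sum_(i < n) f i <= limn (series f).
Proof.
move=> f0 cf; have -> : \sum_(i < n) f i = series f n by rewrite seriesEord.
apply: nondecreasing_cvgn_le => // m k mk.
by rewrite seriesEord /=; exact: partial_sum_mono.
Qed.

(** Dominated convergence for series whose number of terms [N n] also grows: cut
    at a fixed [J] beyond which the dominating series is small. *)
Lemma tannery (u : nat -> nat -> R) (b l : nat -> R) (N : nat -> nat) :
  cvgn (series b) -> (forall n i, `|u n i| <= b i) ->
  (forall i, u n i @[n --> \oo] --> l i) -> (forall n, (n <= N n)%N) ->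
  \sum_(i < N n) u n i @[n --> \oo] --> limn (series l).
Proof.
move=> cb ub ul Nn.
have b0 i : 0 <= b i by exact: le_trans (normr_ge0 _) (ub 0%N i).
have lb i : `|l i| <= b i.
  have c : `|u n i| @[n --> \oo] --> `|l i| by apply: cvg_norm; exact: ul.
  rewrite -(cvg_lim _ c)//; apply: limr_le; first by apply/cvg_ex; eexists; exact: c.
  by apply: nearW => n; exact: ub.
have cl : cvgn (series l).
  apply: normed_cvg; apply: (series_le_cvg _ b0 _ cb) => n //=.
set B := limn (series b); set L := limn (series l).
have tail (v : nat -> R) (K M : nat) : (forall i, `|v i| <= b i) -> (K <= M)%N ->
    `|\sum_(i < M) v i - \sum_(i < K) v i| <= B - \sum_(i < K) b i.
  move=> vb KM; rewrite -!(big_mkord xpredT v) [X in `|X - _|](big_cat_nat (n := K)) //=.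
  rewrite addrAC subrr add0r; apply: le_trans (ler_norm_sum _ _ _) _.
  apply: le_trans (ler_sum _ (fun i _ => vb i)) _.
  rewrite lerBrDl -(big_mkord xpredT b) -(big_cat_nat (n := K)) //= big_mkord.
  exact: series_le_lim.
apply/cvgrPdist_le => e e0.
have e3 : 0 < e / 3 by rewrite divr_gt0.
have [K _ BK] : \forall K \near \oo, `|B - series b K| <= e / 3.
  by move/cvgrPdist_le: cb; exact.
have [K' _ LK] : \forall K \near \oo, `|L - series l K| <= e / 3.
  by move/cvgrPdist_le: cl; exact.
set J := maxn K K'.
have {}BK : B - \sum_(i < J) b i <= e / 3.
  have := BK J (leq_maxl _ _); rewrite seriesEord /=; exact/le_trans/ler_norm.
have {}LK : `|L - \sum_(i < J) l i| <= e / 3.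
  by have := LK J (leq_maxr _ _); rewrite seriesEord.
have fin : \sum_(i < J) u n i @[n --> \oo] --> \sum_(i < J) l i.
  by apply: cvg_big => [|i _]; [exact: add_continuous|exact: ul].
move/cvgrPdist_le: fin => /(_ _ e3); apply: filterS2 (nbhs_infty_ge J) => n Jn H.
have T := tail (u n) J (N n) (ub n) (leq_trans Jn (Nn n)).
have -> : L - \sum_(i < N n) u n i = (L - \sum_(i < J) l i) +
   (\sum_(i < J) l i - \sum_(i < J) u n i) -
   (\sum_(i < N n) u n i - \sum_(i < J) u n i) by ring.
apply: le_trans (ler_normB _ _) _.
have := ler_normD (L - \sum_(i < J) l i) (\sum_(i < J) l i - \sum_(i < J) u n i).
lra.
Qed.

(** Convolution with a summable sequence preserves convergence: the weight sits
    on the terms [a i * x (n - i)] with [i] bounded, where [x (n - i)] is close to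
    its limit. *)
Lemma convolution_cvg (a x : nat -> R) (l B : R) :
  (forall i, 0 <= a i) -> cvgn (series a) -> (forall n, `|x n| <= B) ->
  x n @[n --> \oo] --> l ->
  \sum_(i < n.+1) a i * x (n - i)%N @[n --> \oo] --> limn (series a) * l.
Proof.
move=> a0 ca xB xl.
have -> : limn (series a) * l = limn (series (fun i => a i * l)).
  apply/esym/cvg_lim => //.
  have -> : series (fun i => a i * l) = (fun n => series a n * l).
    by apply: funext => n; rewrite !seriesEord /= mulr_suml.
  exact: cvgMl.
apply: (tannery (u := fun n i => a i * x (n - i)%N) (b := fun i => a i * B)) => //.
- have -> : (fun i => a i * B) = B *: (a : nat -> R^o).
    by apply: funext => i; rewrite mulrC.
  exact: (is_cvg_seriesZ (f := a : nat -> R^o)).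
- by move=> n i; rewrite normrM ger0_norm // ler_wpM2l.
- move=> i; apply: cvgMr.
  by rewrite -(cvg_shiftn i); under eq_fun do rewrite addnK.
Qed.

(** [lam] is the upper limit of [w]; [s] is its sequence of tail suprema. *)
Lemma limsup_subsequence (w : nat -> R) (B : R) : (forall n, `|w n| <= B) ->
  exists (lam : R) (s : nat -> R) (phi : nat -> nat),
    [/\ s n @[n --> \oo] --> lam, forall n, w n <= s n,
        forall k, (k <= phi k)%N & w (phi k) @[k --> \oo] --> lam].
Proof.
move=> wB.
have wub : has_ubound (range w).
  by exists B => _ [n _ <-]; exact: le_trans (ler_norm _) (wB n).
have wlb : has_lbound (range w).
  by exists (- B) => _ [n _ <-]; have := wB n; rewrite ler_norml => /andP[].
have cs := cvg_sups_inf wub wlb.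
set lam := inf _ in cs.
have ws m n : (m <= n)%N -> w n <= sups w m.
  by move=> mn; apply: ub_le_sup; [exact: has_ubound_sdrop | exists n].
have ls n : lam <= sups w n.
  rewrite -(cvg_lim _ cs)//; apply: nonincreasing_cvgn_ge.
    exact: nonincreasing_sups.
  by apply/cvg_ex; exists lam.
have near_sup k : exists n, (k <= n)%N /\ lam - k.+1%:R^-1 < w n.
  have lt_sup : lam - k.+1%:R^-1 < sup (sdrop w k).
    by apply: lt_le_trans (ls k); rewrite ltrBlDr ltrDl invr_gt0.
  have [|_ [n /= kn <-] H] := sup_gt _ lt_sup; last by exists n.
  by exists (w k); exists k => /=.
have [phi Hphi] := choice near_sup.
exists lam, (sups w), phi; split => //.
- by move=> n; exact: ws.
- by move=> k; have [] := Hphi k.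
apply: (@squeeze_cvgr _ _ _ _ (fun k => lam - harmonic k) (sups w)).
- apply: nearW => k; have [kp lw] := Hphi k.
  by rewrite (ltW lw) /= ws.
- rewrite -[X in _ --> X]subr0; apply: cvgB; first exact: cvg_cst.
  exact: cvg_harmonic.
- exact: cs.
Qed.

(** * The renewal theorem *)

(** Passing from [n] to [n.+1] changes the left-hand side by exactly [g n.+1]:
    consecutive coefficients [1 - sum f] differ by one value of [f], so the
    difference is the renewal equation itself.  This conserved quantity is what
    determines the limit. *)
Lemma renewal_tail_identity f g w :
  f 0%N = 0 -> (forall n, w n = g n + \sum_(i < n.+1) f i * w (n - i)%N) ->
  forall n, \sum_(j < n.+1) (1 - \sum_(i < j.+1) f i) * w (n - j)%N =
            \sum_(i < n.+1) g i.
Proof.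
move=> f0 wE; elim=> [|n IH].
  by rewrite !big_ord1 /= f0 subr0 mul1r wE big_ord1 f0 mul0r addr0.
rewrite [RHS]big_ord_recr /= -IH big_ord_recl /= big_ord1 f0 subr0 mul1r subn0.
have := wE n.+1; rewrite big_ord_recl /= f0 mul0r add0r => ->.
rewrite -addrA addrC; congr (_ + _).
rewrite -big_split /=; apply: eq_bigr => i _.
rewrite [in X in _ + X]big_ord_recr /= /bump /= add1n subSS; ring.
Qed.

(** The recursive part is a subconvex combination of earlier values, hence at
    most the bound already obtained for them. *)
Lemma renewal_bound f g w :
  (forall i, 0 <= f i) -> (forall i, 0 <= g i) -> f 0%N = 0 ->
  (forall n, \sum_(i < n) f i <= 1) ->
  (forall n, w n = g n + \sum_(i < n.+1) f i * w (n - i)%N) ->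
  forall n, 0 <= w n <= \sum_(i < n.+1) g i.
Proof.
move=> f0 g0 f00 f1 wE n; have [m] := ubnP n; elim: m n => // m IH n nm.
case: n nm => [|n] nm.
  by rewrite wE !big_ord1 /= f00 mul0r addr0 g0 lexx.
have H (i : 'I_n.+1) : 0 <= f i.+1 * w (n - i)%N <= f i.+1 * \sum_(k < n.+1) g k.
  have /andP[w0 wle] : 0 <= w (n - i)%N <= \sum_(k < (n - i).+1) g k.
    by apply: IH; lia.
  rewrite mulr_ge0 //= ler_wpM2l //; apply: le_trans wle _.
  by apply: partial_sum_mono => //; lia.
rewrite wE big_ord_recl /= f00 mul0r add0r.
under eq_bigr do rewrite /bump /= add1n subSS.
rewrite addr_ge0 //=; last by apply: sumr_ge0 => i _; have /andP[] := H i.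
have -> : \sum_(i < n.+2) g i = g n.+1 + \sum_(i < n.+1) g i.
  by rewrite big_ord_recr addrC.
rewrite lerD2l.
apply: (@le_trans _ _ ((\sum_(i < n.+1) f i.+1) * \sum_(k < n.+1) g k)).
  by rewrite mulr_suml; apply: ler_sum => i _; have /andP[] := H i.
apply: ler_piMl; first by apply: sumr_ge0.
by have := f1 n.+2; rewrite big_ord_recl /= f00 add0r.
Qed.

(** Where [w] is close to its upper limit [lam], the renewal equation writes
    [lam] as an average, with weights [f i], of earlier values that asymptotically
    do not exceed [lam]; so each of those carrying positive weight must be close
    to [lam] too. *)
Lemma renewal_propagate f g w (s : nat -> R) (lam B : R) (j : nat)
    (psi : nat -> nat) :
  (forall i, 0 <= f i) -> cvgn (series f) -> limn (series f) = 1 ->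
  g n @[n --> \oo] --> 0 -> (forall n, `|w n| <= B) ->
  (forall n, w n = g n + \sum_(i < n.+1) f i * w (n - i)%N) ->
  s n @[n --> \oo] --> lam -> (forall n, w n <= s n) ->
  0 < f j -> psi k @[k --> \oo] --> \oo ->
  w (psi k) @[k --> \oo] --> lam -> w (psi k - j)%N @[k --> \oo] --> lam.
Proof.
move=> f0 cf f1 g0 wB wE sl ws fj psioo wl.
have along (h : nat -> R) (l : R) : h n @[n --> \oo] --> l -> h (psi k) @[k --> \oo] --> l.
  by move=> hl; exact: (cvg_comp _ _ psioo hl).
(* [e n] is the total defect of [w] with respect to [s], averaged by [f]. *)
pose e n := \sum_(i < n.+1) f i * s (n - i)%N - (w n - g n).
have [M [_ HM]] := cvg_seq_bounded (cvgP _ sl).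
have e0 : e (psi k) @[k --> \oo] --> 0.
  rewrite -[X in _ --> X](subrr lam) -{1}[lam]mul1r -[in X in _ --> _ - X](subr0 lam).
  apply: cvgB; last by apply: cvgB => //; exact: along.
  apply: (along (fun n => \sum_(i < n.+1) f i * s (n - i)%N)).
  rewrite -f1; apply: (@convolution_cvg _ _ _ (M + 1)) => // n.
  by apply: HM => //; rewrite ltrDl.
have low k : (j <= psi k)%N ->
    0 <= s (psi k - j)%N - w (psi k - j)%N <= (f j)^-1 * e (psi k).
  move=> jk; rewrite subr_ge0 ws /= ler_pdivlMl //.
  rewrite /e [w (psi k)]wE [g _ + _]addrC addrK -sumrB.
  have jlt : (j < (psi k).+1)%N by [].
  rewrite (bigD1 (Ordinal jlt)) //= -mulrBr lerDl.
  by apply: sumr_ge0 => i _; rewrite -mulrBr mulr_ge0 // subr_ge0.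
have shl : s (psi k - j)%N @[k --> \oo] --> lam.
  apply: (along (fun n => s (n - j)%N)).
  by rewrite -(cvg_shiftn j); under eq_fun do rewrite addnK.
have d0 : s (psi k - j)%N - w (psi k - j)%N @[k --> \oo] --> 0.
  apply: (@squeeze_cvgr _ _ _ _ (fun=> 0) (fun k => (f j)^-1 * e (psi k))).
  - have /cvgnyPge/(_ j) := psioo; apply: filterS => k; exact: low.
  - exact: cvg_cst.
  - by rewrite -[X in _ --> X](mulr0 (f j)^-1); apply: cvgMr.
have -> : (fun k => w (psi k - j)%N) =
    (fun k => s (psi k - j)%N - (s (psi k - j)%N - w (psi k - j)%N)).
  by apply: funext => k; rewrite subKr.
by rewrite -[X in _ --> X]subr0; apply: cvgB.
Qed.

(** [D] stands for a set of times that decompose into steps of the support of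
    [f].  Going back along such a decomposition propagates nearness to the upper
    limit, and since [D] contains all large times there are arbitrarily long
    windows, ending at [psi k], on which [w] is nearly constant. *)
Lemma renewal_extremal f g w (D : nat -> Prop) (N0 : nat) (B : R) :
  (forall i, 0 <= f i) -> cvgn (series f) -> limn (series f) = 1 ->
  g n @[n --> \oo] --> 0 -> (forall n, `|w n| <= B) ->
  (forall n, w n = g n + \sum_(i < n.+1) f i * w (n - i)%N) ->
  (forall n, (N0 <= n)%N -> D n) ->
  (forall n, (0 < n)%N -> D n ->
     exists j, [/\ (0 < j <= n)%N, 0 < f j & D (n - j)%N]) ->
  exists (lam : R) (s : nat -> R) (psi : nat -> nat),
    [/\ s n @[n --> \oo] --> lam, forall n, w n <= s n,
        forall k, (k <= psi k)%N &
        forall j, w (psi k - j)%N @[k --> \oo] --> lam].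
Proof.
move=> f0 cf f1 g0 wB wE DN0 Dstep.
have [lam [s [phi [sl ws kphi wphi]]]] := limsup_subsequence wB.
have back a : D a -> w (phi k - a)%N @[k --> \oo] --> lam.
  have [m] := ubnP a; elim: m a => // m IH a am Da.
  case: (posnP a) => [->|a0]; first by under eq_fun do rewrite subn0.
  have [j [/andP[j0 ja] fj Daj]] := Dstep a a0 Da.
  have -> : (fun k => w (phi k - a)%N) = (fun k => w (phi k - (a - j) - j)%N).
    by apply: funext => k; rewrite -subnDA subnK.
  apply: (renewal_propagate f0 cf f1 g0 wB wE sl ws fj); last first.
    by apply: IH => //; lia.
  apply/cvgnyPge => A; near=> k.
  have := kphi k; have : (A + a <= k)%N by near: k; exact: nbhs_infty_ge.
  lia.
(* Shifting by [N0] turns the times [N0 + j], all in [D], into every [j]. *)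
exists lam, s, (fun k => phi (k + N0)%N - N0)%N; split => //.
  by move=> k; have := kphi (k + N0)%N; lia.
move=> j; have := back (N0 + j)%N (DN0 _ (leq_addr _ _)).
rewrite -(cvg_shiftn N0) => H.
have -> // : (fun k => w (phi (k + N0) - N0 - j)%N) =
    [sequence w (phi (n + N0) - (N0 + j))%N]_n.
by apply: funext => k /=; rewrite subnDA.
Unshelve. all: by end_near. Qed.

(** On windows where [w] is nearly the constant [lam], the conserved quantity of
    [renewal_tail_identity] tends to [lam * sum r].  When [f] has mass 1, [sum r]
    is its mean. *)
Lemma renewal_mean f g w (r : nat -> R) (psi : nat -> nat) (lam B : R) :
  r = (fun j => 1 - \sum_(i < j.+1) f i) -> (forall j, 0 <= r j) ->
  f 0%N = 0 -> cvgn (series g) -> (forall n, `|w n| <= B) ->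
  (forall n, w n = g n + \sum_(i < n.+1) f i * w (n - i)%N) ->
  (forall k, (k <= psi k)%N) ->
  (forall j, w (psi k - j)%N @[k --> \oo] --> lam) ->
  cvgn (series r) -> limn (series r) * lam = limn (series g).
Proof.
move=> rE r0 f0 cg wB wE psik wl cr.
have tail n : \sum_(j < n.+1) r j * w (n - j)%N = \sum_(i < n.+1) g i.
  by rewrite -(renewal_tail_identity f0 wE) rE.
have psioo : psi k @[k --> \oo] --> \oo.
  by apply/cvgnyPge => A; exists A => // k /= Ak; exact: leq_trans (psik k).
have c1 : \sum_(j < (psi k).+1) r j * w (psi k - j)%N @[k --> \oo] -->
    limn (series (fun j => r j * lam)).
  apply: (tannery (u := fun k j => r j * w (psi k - j)%N) (b := fun j => r j * B)
    (N := fun k => (psi k).+1)).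
  - have -> : (fun i => r i * B) = B *: (r : nat -> R^o).
      by apply: funext => i; rewrite mulrC.
    exact: (is_cvg_seriesZ (f := r : nat -> R^o)).
  - by move=> n i; rewrite normrM ger0_norm // ler_wpM2l.
  - by move=> i; apply: cvgMr.
  - by move=> n; exact: leq_trans (psik n) _.
have c2 : \sum_(j < (psi k).+1) r j * w (psi k - j)%N @[k --> \oo] --> limn (series g).
  under eq_fun do rewrite tail.
  have : series g (n.+1) @[n --> \oo] --> limn (series g) by rewrite cvg_shiftS.
  by move=> /(cvg_comp _ _ psioo); rewrite seriesEord.
have -> : limn (series r) * lam = limn (series (fun j => r j * lam)).
  apply/esym/cvg_lim => //.
  have -> : series (fun i => r i * lam) = (fun n => series r n * lam).
    by apply: funext => n; rewrite !seriesEord /= mulr_suml.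
  exact: cvgMl.
exact: cvg_unique c1 c2.
Qed.

(** The renewal theorem of Erdos, Feller and Pollard, with [f] possibly defective
    and the aperiodicity of its support expressed by [D].  If [f] has mass 1 and
    finite mean, [renewal_mean] applied to [w] and to [- w] gives the same value
    for the upper and the lower limit; in the other cases the limit is 0. *)
Theorem renewal_cvg f g w (D : nat -> Prop) (N0 : nat) :
  (forall i, 0 <= f i) -> f 0%N = 0 -> (forall n, \sum_(i < n) f i <= 1) ->
  (forall i, 0 <= g i) -> cvgn (series g) ->
  (forall n, w n = g n + \sum_(i < n.+1) f i * w (n - i)%N) ->
  (forall n, (N0 <= n)%N -> D n) ->
  (forall n, (0 < n)%N -> D n ->
     exists j, [/\ (0 < j <= n)%N, 0 < f j & D (n - j)%N]) ->
  cvgn w.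
Proof.
move=> f0 f00 f1 g0 cg wE DN0 Dstep.
have cf : cvgn (series f) by exact: cvg_nonneg_series f1.
set G := limn (series g).
have wb := renewal_bound f0 g0 f00 f1 wE.
have w0 n : 0 <= w n by have /andP[] := wb n.
have gG n : \sum_(i < n) g i <= G by exact: series_le_lim.
have wG n : w n <= G by have /andP[_ h] := wb n; exact: le_trans h (gG _).
have wB n : `|w n| <= G by rewrite ger0_norm.
have gz : g n @[n --> \oo] --> 0 by exact: cvg_series_cvg_0.
have tail := renewal_tail_identity f00 wE.
pose r j := 1 - \sum_(i < j.+1) f i.
have r0 j : 0 <= r j by rewrite subr_ge0.
have F1 : limn (series f) <= 1.
  by apply: limr_le => //; apply: nearW => n; rewrite seriesEord /= f1.
have [F1'|FE] : limn (series f) < 1 \/ limn (series f) = 1.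
  by move: F1; rewrite le_eqVlt => /orP[/eqP|]; [right|left].
  (* All the coefficients of the conserved quantity are at least [1 - F > 0], so
     [w] is summable. *)
  set F := limn _ in F1'.
  have cw : cvgn (series w).
    apply: (@cvg_nonneg_series _ ((1 - F)^-1 * G)) => // n.
    rewrite ler_pdivlMl ?subr_gt0 //.
    apply: le_trans (gG n.+1); rewrite -tail.
    apply: (@le_trans _ _ ((1 - F) * \sum_(i < n.+1) w i)).
      by rewrite ler_pM2l ?subr_gt0 //; exact: partial_sum_mono.
    rewrite (reindex_inj rev_ord_inj) /= mulr_sumr; apply: ler_sum => i _.
    rewrite subSS ler_wpM2r // lerD2l lerN2; exact: series_le_lim.
  by apply/cvg_ex; exists 0; exact: cvg_series_cvg_0.
have [lam [s [psi [sl ws psik wpsi]]]] :=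
  renewal_extremal f0 cf FE gz wB wE DN0 Dstep.
have [cr|ncr] := pselect (cvgn (series r)).
  have wNE n : - w n = - g n + \sum_(i < n.+1) f i * - w (n - i)%N.
    by rewrite {1}wE opprD -sumrN; congr (_ + _); apply: eq_bigr => i _; rewrite mulrN.
  have wNB n : `|- w n| <= G by rewrite normrN.
  have gNz : - g n @[n --> \oo] --> 0 by rewrite -[X in _ --> X]oppr0; exact: cvgN.
  have [lam' [s' [psi' [sl' ws' psik' wpsi']]]] :=
    renewal_extremal f0 cf FE gNz wNB wNE DN0 Dstep.
  have E1 := renewal_mean erefl r0 f00 cg wB wE psik wpsi cr.
  have cgN : cvgn (series (- g : nat -> R^o)) by rewrite is_cvg_seriesN.
  have E2 := renewal_mean erefl r0 f00 cgN wNB wNE psik' wpsi' cr.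
  rewrite lim_seriesN // in E2.
  have rho : limn (series r) != 0.
    rewrite gt_eqF //; apply: lt_le_trans (series_le_lim 1 r0 cr).
    by rewrite big_ord1 /r big_ord1 f00 subr0.
  have lamE : lam' = - lam.
    by apply: (mulfI rho); rewrite E2 mulrN E1.
  apply/cvg_ex; exists lam.
  apply: (@squeeze_cvgr _ _ _ _ (fun n => - s' n) s) => //.
    by apply: nearW => n; rewrite ws andbT lerNl.
  by rewrite -[lam]opprK -lamE; exact: cvgN.
(* The mean is infinite: a positive upper limit would make the conserved
   quantity exceed [G]. *)
have lam0 : 0 <= lam.
  rewrite -(cvg_lim _ sl) //; apply: limr_ge; first by apply/cvg_ex; exists lam.
  by apply: nearW => n; exact: le_trans (w0 n) (ws n).
have [lam_gt0|lam_le0] := ltP 0 lam; last first.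
  have lamE : lam = 0 by apply/eqP; rewrite eq_le lam0 lam_le0.
  apply/cvg_ex; exists 0; apply: (@squeeze_cvgr _ _ _ _ (fun=> 0) s).
  - by apply: nearW => n; rewrite w0 ws.
  - exact: cvg_cst.
  - by rewrite -lamE.
exfalso; apply: ncr; apply: (@cvg_nonneg_series _ (G / lam)) => // K.
rewrite ler_pdivlMr // mulr_suml.
have c : \sum_(j < K) r j * w (psi k - j)%N @[k --> \oo] --> \sum_(j < K) r j * lam.
  by apply: cvg_big => [|i _]; [exact: add_continuous|apply: cvgMr].
rewrite -(cvg_lim _ c) //; apply: limr_le; first by apply/cvg_ex; eexists; exact: c.
exists K => // k /= Kk; apply: le_trans (gG (psi k).+1); rewrite -tail.
apply: (@partial_sum_mono (fun j => r j * w (psi k - j)%N)) => [i|].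
  exact: mulr_ge0.
exact: leq_trans (leq_trans Kk (psik k)) _.
Qed.

(** * Submultiplicative sequences *)

(** Advancing by [M] steps does not increase [N n / expR (c * n)], so this ratio is
    bounded by its values at the times below [M]. *)
Lemma submult_growth (N : nat -> R) (c : R) (M : nat) :
  (forall n, 0 <= N n) -> (forall m n, N (m + n)%N <= N m * N n) ->
  (0 < M)%N -> N M <= expR (c * M%:R) ->
  exists2 C, 0 < C & forall n, N n <= C * expR (c * n%:R).
Proof.
move=> N0 Nsub M0 NM.
pose x n := N n * expR (- (c * n%:R)).
have x0 n : 0 <= x n by rewrite mulr_ge0 ?expR_ge0.
have xM n : x (M + n)%N <= x n.
  rewrite /x natrD mulrDr opprD expRD mulrCA.
  rewrite mulrA ler_pM2r ?expR_gt0 // expRN ler_pdivrMl ?expR_gt0 //.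
  by apply: le_trans (Nsub M n) _; rewrite ler_wpM2r.
pose C := 1 + \sum_(r < M) x r.
have C0 : 0 < C by rewrite ltr_wpDr // sumr_ge0.
exists C => // n.
have : x n <= C.
  have [m] := ubnP n; elim: m n => // m IH n nm.
  have [nM|Mn] := ltnP n M.
    rewrite /C (bigD1 (Ordinal nM)) //= addrCA lerDl addr_ge0 //.
    exact: sumr_ge0.
  by rewrite -(subnKC Mn); apply: le_trans (xM _) _; apply: IH; lia.
by rewrite /x expRN ler_pdivrMr ?expR_gt0.
Qed.

(** The partial sums satisfy [S_(M+n) <= S_M + x_M S_n]. *)
Lemma submult_summable (x : nat -> R) (M : nat) :
  (forall n, 0 <= x n) -> (forall m n, x (m + n)%N <= x m * x n) ->
  x M < 1 -> cvgn (series x).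
Proof.
move=> x0 xsub xM.
apply: (@cvg_nonneg_series _ ((\sum_(i < M) x i) / (1 - x M))) => // n.
rewrite ler_pdivlMr ?subr_gt0 // mulrBr mulr1 lerBlDr.
apply: (@le_trans _ _ (\sum_(i < M + n) x i)).
  by apply: partial_sum_mono => //; rewrite leq_addl.
rewrite big_split_ord /= lerD2l mulrC mulr_sumr.
by apply: ler_sum => i _; exact: xsub.
Qed.

(** Fekete's lemma. *)
Lemma fekete_cvg (N : nat -> R) :
  (forall n, 1 <= N n) -> (forall m n, N (m + n)%N <= N m * N n) ->
  cvgn (fun n => n%:R^-1 * ln (N n)).
Proof.
move=> N1 Nsub.
pose E := [set n%:R^-1 * ln (N n) | n in [set n | 0 < n]%N].
have E0 : E !=set0 by exists (1%:R^-1 * ln (N 1%N)); exists 1%N.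
have Elb : has_lbound E.
  by exists 0 => _ [n /= _ <-]; rewrite mulr_ge0 ?invr_ge0 ?ler0n ?ln_ge0.
apply/cvg_ex; exists (inf E); apply/cvgrPdist_le => e e0.
have e2 : 0 < e / 2 by rewrite divr_gt0.
have [_ [M /= M0 <-] HM] : exists2 y, E y & y < inf E + e / 2.
  by apply: inf_lt => //; rewrite ltrDl.
have N0 n : 0 <= N n by exact: le_trans (N1 n).
have NM : N M <= expR ((inf E + e / 2) * M%:R).
  rewrite -[leLHS]lnK ?ler_expR; last by rewrite posrE; exact: lt_le_trans (N1 M).
  by move: HM; rewrite mulrC ltr_pdivrMr ?ltr0n // => /ltW.
have [C C0 HC] := submult_growth N0 Nsub M0 NM.
have lnC n : ln (N n) <= ln C + (inf E + e / 2) * n%:R.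
  rewrite -[X in _ + X]expRK -lnM ?posrE ?expR_gt0 //.
  by rewrite ler_ln ?posrE ?mulr_gt0 ?expR_gt0 //; exact: lt_le_trans (N1 n).
near=> n.
have n0 : (0 < n)%N by near: n; exact: nbhs_infty_gt.
have nR : 0 < n%:R :> R by rewrite ltr0n.
have lo : inf E <= n%:R^-1 * ln (N n) by apply: ge_inf => //; exists n.
rewrite distrC ger0_norm ?subr_ge0 // lerBlDl mulrC ler_pdivrMr //.
apply: le_trans (lnC n) _.
have : ln C / (e / 2) <= n%:R by near: n; exact: nbhs_infty_ger.
rewrite ler_pdivrMr // !mulrDl; lra.
Unshelve. all: by end_near. Qed.

Lemma submult_growth_lim (N : nat -> R) (c : R) :
  (forall n, 1 <= N n) -> (forall m n, N (m + n)%N <= N m * N n) ->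
  limn (fun n => n%:R^-1 * ln (N n)) < c ->
  exists2 C, 0 < C & forall n, N n <= C * expR (c * n%:R).
Proof.
move=> N1 Nsub hc.
have cv := fekete_cvg N1 Nsub.
have [M _ HM] : \forall n \near \oo, n%:R^-1 * ln (N n) < c.
  exact: (cvgr_lt _ cv).
apply: (@submult_growth N c M.+1) => //.
- by move=> n; exact: le_trans (N1 n).
- rewrite -[leLHS]lnK ?ler_expR; last by rewrite posrE; exact: lt_le_trans (N1 _).
  by have := HM M.+1 (leqnSn _); rewrite mulrC ltr_pdivrMr ?ltr0n // => /ltW.
Qed.

Lemma le_of_pow_le (a b C : R) : 0 <= a -> 0 <= b ->
  (forall q : nat, b ^+ q <= C * a ^+ q) -> b <= a.
Proof.
move=> a0 b0 H; rewrite leNgt; apply/negP => ab.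
have bpos : 0 < b by exact: le_lt_trans ab.
have c0 : C * (a / b) ^+ q @[q --> \oo] --> C * 0.
  apply: cvgMr; apply: cvg_expr.
  by rewrite ger0_norm ?divr_ge0 // ltr_pdivrMr // mul1r.
have : 1 <= limn (fun q => C * (a / b) ^+ q).
  apply: limr_ge; first by apply/cvg_ex; eexists; exact: c0.
  apply: nearW => q; rewrite exprMn exprVn mulrA ler_pdivlMr ?exprn_gt0 //.
  by rewrite mul1r.
by rewrite (cvg_lim _ c0) // mulr0 ler10.
Qed.

(** If the first [J] weights had sum [F > 1], the partial sums [S] of [w] would
    satisfy [F S_M <= S_(M+J)], so [w] would grow exponentially. *)
Lemma renewal_mass_le1 f g w :
  (forall i, 0 <= f i) -> (forall i, 0 <= g i) -> f 0%N = 0 ->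
  (forall n, 0 <= w n) -> 0 < w 0%N ->
  (forall n, w n = g n + \sum_(i < n.+1) f i * w (n - i)%N) ->
  (forall e, 0 < e -> exists2 C, 0 < C & forall n, w n <= C * expR (e * n%:R)) ->
  forall J, \sum_(i < J) f i <= 1.
Proof.
move=> f0 g0 f00 w0 w00 wE wsub J.
set F := \sum_(i < J) f i.
have F0 : 0 <= F by exact: sumr_ge0.
pose S M := \sum_(m < M) w m.
have tail := renewal_tail_identity f00 wE.
case: (posnP J) => [J0|J0]; first by rewrite /F J0 big_ord0.
(* In the conserved quantity at time [M + J - 1], the coefficient of [w m] is at
   most 1, and at most [1 - F] when [m < M]. *)
have step M : F * S M <= S (M + J)%N.
  have -> : S M = \sum_(i < M + J) (if (i < M)%N then w i else 0).
    by rewrite /S (@big_ord_widen _ _ _ M (M + J)%N w) ?leq_addr // big_mkcond.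
  rewrite -subr_ge0 /S mulr_sumr -sumrB.
  case def : (M + J)%N => [|n]; first by lia.
  apply: (@le_trans _ _ (\sum_(i < n.+1) g i)); first exact: sumr_ge0.
  rewrite -tail (reindex_inj rev_ord_inj) /=; apply: ler_sum => m _.
  have mn : (m <= n)%N by rewrite -ltnS.
  rewrite subSS subKn //; case: ifPn => mM.
    rewrite -[X in _ <= X - _]mul1r -mulrBl ler_wpM2r // lerD2l lerN2.
    by apply: partial_sum_mono => //; lia.
  rewrite mulr0 subr0 -[leRHS]mul1r ler_wpM2r // gerDl oppr_le0.
  exact: sumr_ge0.
have low t : F ^+ t * w 0%N <= S (1 + t * J)%N.
  elim: t => [|t IH]; first by rewrite expr0 mul1r /S mul0n addn0 big_ord1.
  rewrite exprS -mulrA mulSn [(J + _)%N]addnC addnA.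
  by apply: le_trans (step _); rewrite ler_wpM2l.
have up e : 0 < e -> F <= expR (2 * e * J%:R).
  move=> e0; have [C C0 HC] := wsub e e0.
  have HS n : S n <= C / e * expR (2 * e * n%:R).
    apply: (@le_trans _ _ (C * n%:R * expR (e * n%:R))).
      apply: (@le_trans _ _ (\sum_(m < n) C * expR (e * n%:R))).
        apply: ler_sum => m _; apply: le_trans (HC _) _.
        by rewrite ler_pM2l // ler_expR ler_pM2l // ler_nat ltnW.
      by rewrite sumr_const card_ord -[leLHS]mulr_natr mulrAC.
    have -> : 2 * e * n%:R = e * n%:R + e * n%:R by ring.
    rewrite expRD mulrA ler_pM2r ?expR_gt0 // -mulrA ler_pM2l //.
    rewrite ler_pdivlMl //; apply: le_trans (expR_ge1Dx _); lra.
  apply: (@le_of_pow_le _ _ (C / e * expR (2 * e) / w 0%N)) => // q.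
  have -> : C / e * expR (2 * e) / w 0%N * expR (2 * e * J%:R) ^+ q =
            C / e * expR (2 * e * (1 + q * J)%N%:R) / w 0%N.
    rewrite natrD natrM mulrDr expRD mulr1 [q%:R * _]mulrC [X in _ * expR X]mulrA.
    by rewrite (expRM_natr q); ring.
  by rewrite ler_pdivlMr //; apply: le_trans (low q) (HS _).
rewrite leNgt; apply/negP => F1.
have lnF : 0 < ln F by rewrite ln_gt0.
have JR : 0 < J%:R :> R by rewrite ltr0n.
have := up (ln F / (4 * J%:R)) (divr_gt0 lnF (mulr_gt0 (ltr0n _ 4) JR)).
rewrite -{1}(lnK (_ : F \is Num.pos)) ?posrE ?(lt_trans _ F1) // ler_expR.
have -> : 2 * (ln F / (4 * J%:R)) * J%:R = ln F / 2.
  by field; rewrite gt_eqF.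
lra.
Qed.

End Analysis.

(** * Counting words by cutting at an occurrence *)

Section Counting.
Variable A : finType.
Implicit Types (P Q S : pred (seq A)) (w : seq A).

Definition count_words P (n : nat) : nat := #|[set w : n.-tuple A | P w]%SET|.

Lemma count_wordsE P n : count_words P n = (\sum_(w : n.-tuple A) P w)%N.
Proof.
rewrite /count_words -sum1_card big_mkcond /=.
by apply: eq_bigr => w _; rewrite inE; case: (P w).
Qed.

Lemma count_words_gt0 P w : P w -> (0 < count_words P (size w))%N.
Proof.
by move=> Pw; rewrite card_gt0; apply/set0Pn; exists (in_tuple w); rewrite inE.
Qed.

Lemma count_words_predT n : count_words predT n = (#|A| ^ n)%N.
Proof. by rewrite /count_words -card_tuple; apply: eq_card => w; rewrite inE. Qed.

Lemma count_words_le P Q n : (forall w, size w = n -> P w -> Q w) ->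
  (count_words P n <= count_words Q n)%N.
Proof.
move=> PQ; rewrite !count_wordsE; apply: leq_sum => w _.
by case: (boolP (P w)) => // Pw; rewrite (PQ w) // size_tuple.
Qed.

Lemma count_words_cat P Q S m n :
  (forall w, size w = (m + n)%N -> S w -> P (take m w) && Q (drop m w)) ->
  (count_words S (m + n) <= count_words P m * count_words Q n)%N.
Proof.
move=> SPQ; rewrite /count_words -cardsX.
pose g (pq : m.-tuple A * n.-tuple A) := [tuple of pq.1 ++ pq.2].
apply: leq_trans (leq_imset_card g _); apply/subset_leq_card/fintype.subsetP => w.
rewrite inE => Sw.
have sp : size (take m w) == m by rewrite size_take_min size_tuple; apply/eqP; lia.
have sq : size (drop m w) == n by rewrite size_drop size_tuple; apply/eqP; lia.
apply/imsetP; exists (Tuple sp, Tuple sq); rewrite ?inE /=.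
  by apply: SPQ => //; rewrite size_tuple.
by apply: val_inj; rewrite /= cat_take_drop.
Qed.

(** Gluing [p] and [q] along a common copy of [v] inverts the operation of cutting
    a word at a given position [i] where [v] occurs. *)
Lemma count_words_glue P Q (v : seq A) n i :
  (i <= n)%N -> (forall p, P p -> suffix v p) -> (forall q, Q q -> prefix v q) ->
  (\sum_(w : (n + size v).-tuple A) (P (take (i + size v) w) && Q (drop i w)) =
   count_words P (i + size v) * count_words Q (n - i + size v))%N.
Proof.
move=> le_in Pv Qv; set k := size v.
have gs (pq : (i + k).-tuple A * (n - i + k).-tuple A) :
    size (pq.1 ++ drop k pq.2) == (n + k)%N.
  by rewrite size_cat size_drop !size_tuple; apply/eqP; lia.
pose g pq := Tuple (gs pq).
rewrite -(count_wordsE (fun w => P (take (i + k) w) && Q (drop i w))).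
rewrite /count_words -cardsX -(card_in_imset (f := g)).
  apply: eq_card => w; rewrite !inE; apply/idP/imsetP.
    move=> /andP[Pp Qq].
    have sp : size (take (i + k) w) == (i + k)%N.
      by rewrite size_take_min size_tuple; apply/eqP; lia.
    have sq : size (drop i w) == (n - i + k)%N.
      by rewrite size_drop size_tuple; apply/eqP; lia.
    exists (Tuple sp, Tuple sq); rewrite ?inE ?Pp //.
    by apply: val_inj; rewrite /= drop_drop [(k + i)%N]addnC cat_take_drop.
  case=> -[p q]; rewrite !inE /= => /andP[Pp Qq] -> /=.
  rewrite take_size_cat ?size_tuple // Pp /=.
  have [s ps] := suffixP (Pv _ Pp); have [t qt] := prefixP (Qv _ Qq).
  have si : size s = i.
    by have := size_tuple p; rewrite ps size_cat => /addIn.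
  have dq : drop k q = t by rewrite qt drop_size_cat.
  by rewrite dq ps -catA drop_size_cat // -qt.
move=> [p q] [p' q']; rewrite !inE /= => /andP[Pp Qq] /andP[Pp' Qq'].
move=> /(congr1 val) /= /eqP; rewrite eqseq_cat ?size_tuple // => /andP[/eqP pp /eqP qq].
have [t qt] := prefixP (Qv _ Qq); have [t' qt'] := prefixP (Qv _ Qq').
congr (_, _); apply: val_inj => //=.
by move: qq; rewrite qt qt' !drop_size_cat // => ->.
Qed.

(** The hypothesis on [S] says that a word of [S] has exactly one admissible
    cutting position, and that a word outside of [S] has none. *)
Lemma count_words_decomp P Q S (v : seq A) n :
  (forall p, P p -> suffix v p) -> (forall q, Q q -> prefix v q) ->
  (forall w, size w = (n + size v)%N ->
     S w = (\sum_(i < n.+1) (P (take (i + size v) w) && Q (drop i w)))%N :> nat) ->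
  count_words S (n + size v) =
    (\sum_(i < n.+1) count_words P (i + size v) * count_words Q (n - i + size v))%N.
Proof.
move=> Pv Qv SPQ; rewrite count_wordsE.
under eq_bigr => w _ do rewrite (SPQ w (size_tuple w)).
rewrite exchange_big /=; apply: eq_bigr => i _.
by rewrite count_words_glue // -ltnS.
Qed.

Definition occurs_at (v w : seq A) (i : nat) := take (size v) (drop i w) == v.

Lemma occurs_at_infix v w i : occurs_at v w i -> infix v w.
Proof.
move=> /eqP o; apply/infixP; exists (take i w), (drop (size v) (drop i w)).
by rewrite -{1}o cat_take_drop cat_take_drop.
Qed.

Lemma infix_occurs_at v w : infix v w -> exists i, occurs_at v w i.
Proof.
move=> /infixP[s [t ->]]; exists (size s).
by rewrite /occurs_at drop_size_cat // take_size_cat.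
Qed.

Lemma occurs_at_size v w i : (0 < size v)%N -> occurs_at v w i ->
  (i + size v <= size w)%N.
Proof.
move=> v0 /eqP e.
have : size (take (size v) (drop i w)) = size v by rewrite e.
by rewrite size_take_min size_drop; lia.
Qed.

Lemma occurs_at_take v w i n : (0 < size v)%N ->
  occurs_at v (take n w) i = occurs_at v w i && (i + size v <= n)%N.
Proof.
move=> v0; apply/idP/andP => [occ|[/eqP occ iv]].
  have := occurs_at_size v0 occ; rewrite size_take_min => sz.
  split; last by lia.
  move: occ; rewrite /occurs_at; congr (_ == _).
  rewrite take_drop addnC -take_min.
  have -> : minn (i + size v) n = (i + size v)%N by lia.
  by rewrite addnC -take_drop.
apply/eqP; rewrite -[RHS]occ take_drop -take_min.
have -> : minn (size v + i) n = (size v + i)%N by lia.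
by rewrite -take_drop.
Qed.

(** The truncation removes the last letter of the occurrence at [i], so it kills
    that occurrence and keeps all the earlier ones. *)
Definition first_at v w i := occurs_at v w i && ~~ infix v (take (i + size v).-1 w).

Lemma sum_first_at v w m : (0 < size v)%N -> (size w < m + size v)%N ->
  (\sum_(i < m) first_at v w i)%N = infix v w.
Proof.
move=> v0 wm; case: (boolP (infix v w)) => [iv|niv]; last first.
  apply: big1 => i _; rewrite /first_at; case: (boolP (occurs_at v w i)) => //= o.
  by rewrite (occurs_at_infix o) in niv.
have ex : exists i, occurs_at v w i by exact: infix_occurs_at.
case: (ex_minnP ex) => i0 o0 mini.
have i0m : (i0 < m)%N by have := occurs_at_size v0 o0; lia.
have first0 : first_at v w i0.
  rewrite /first_at o0; apply/negP => /infix_occurs_at[j].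
  by rewrite occurs_at_take // => /andP[/mini]; lia.
rewrite (bigD1 (Ordinal i0m)) //= first0 big1 // => i ne.
rewrite /first_at; case: (boolP (occurs_at v w i)) => //= o.
rewrite (_ : infix _ _ = true) //; apply: (@occurs_at_infix _ _ i0).
rewrite occurs_at_take // o0 /=.
have : i0 != i by apply: contraNneq ne => e; apply/eqP/val_inj.
by have := mini _ o; lia.
Qed.

Variables (L : pred (seq A)) (v : seq A).
Hypothesis v_gt0 : (0 < size v)%N.
Hypothesis L_factor : forall p w s, L (p ++ w ++ s) -> L w.
Hypothesis v_sync : forall u w, L (u ++ v) -> L (v ++ w) -> L (u ++ v ++ w).
Local Notation k := (size v).

Definition avoiding w := L w && ~~ infix v w.
Definition first_hit w := [&& L w, suffix v w & ~~ infix v (take (size w).-1 w)].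
Definition starting w := L w && prefix v w.
Definition no_return w := starting w && ~~ infix v (behead w).
Definition first_return w :=
  [&& starting w, suffix v w, (k < size w)%N &
      ~~ infix v (behead (take (size w).-1 w))].

(** Synchronization makes the two pieces of a cut independent of each other. *)
Lemma L_cut w i : occurs_at v w i -> L w = L (take (i + k) w) && L (drop i w).
Proof.
move=> /eqP o.
have di : drop i w = v ++ drop (i + k) w.
  by rewrite -{1}[drop i w](cat_take_drop k) o drop_drop addnC.
have ti : take (i + k) w = take i w ++ v by rewrite takeD o.
rewrite di ti; apply/idP/andP => [Lw|[Lu Lt]].
  split; first by apply: (@L_factor [::] _ (drop (i + k) w)); rewrite -ti cat_take_drop.
  by apply: (@L_factor (take i w) _ [::]); rewrite cats0 -di cat_take_drop.
by rewrite -(cat_take_drop i w) di; exact: v_sync.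
Qed.

Lemma suffix_take w i : (i + k <= size w)%N -> suffix v (take (i + k) w) = occurs_at v w i.
Proof.
by move=> iw; rewrite suffixE size_takel // addnK addnC -take_drop.
Qed.

Lemma language_decomp n :
  count_words L (n + k) = (count_words avoiding (n + k) +
    \sum_(i < n.+1) count_words first_hit (i + k) *
                    count_words starting (n - i + k))%N.
Proof.
rewrite -(count_words_decomp (S := fun w => L w && infix v w)).
- rewrite !count_wordsE -big_split /=; apply: eq_bigr => w _.
  by rewrite /avoiding; case: (L w) (infix v w) => [] [].
- by move=> p /and3P[].
- by move=> q /andP[].
move=> w sw.
transitivity (L w * \sum_(i < n.+1) first_at v w i)%N.
  by rewrite sum_first_at // ?sw //; case: (L w) (infix v w) => [] [].
rewrite big_distrr /=; apply: eq_bigr => i _.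
have iw : (i + k <= size w)%N by rewrite sw leq_add2r -ltnS.
rewrite /first_hit /starting /first_at suffix_take // prefixE -/(occurs_at v w i).
rewrite size_takel // take_takel ?leq_pred //.
case: (boolP (occurs_at v w i)) => [occ|_]; last by rewrite !andbF muln0.
by rewrite (L_cut occ) mulnb; case: (L (take _ _)); case: (L (drop _ _)); case: (infix _ _).
Qed.

(** The next occurrence of [v] after the one at position 0 is the first occurrence
    in the word without its first letter; hence the shift of [first_at] by one.
    It may overlap the occurrence at 0. *)
Lemma starting_decomp_word n w : size w = (n + k)%N ->
  (starting w && infix v (behead w)) =
  (\sum_(i < n.+1) (first_return (take (i + k) w) && starting (drop i w)))%N :> nat.
Proof.
move=> sw; rewrite big_ord_recl /= add0n /first_return.
have kw : (k <= size w)%N by rewrite sw leq_addl.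
rewrite size_takel // ltnn !andbF /= add0n.
transitivity (starting w * \sum_(i < n) first_at v (behead w) i)%N.
  rewrite sum_first_at // ?mulnb // size_behead sw; lia.
rewrite big_distrr /=; apply: eq_bigr => i _; rewrite /bump /= add1n.
have iw : (i.+1 + k <= size w)%N by rewrite sw leq_add2r.
have ob : occurs_at v (behead w) i = occurs_at v w i.+1.
  by rewrite /occurs_at -drop1 drop_drop addn1.
rewrite /first_at ob /starting suffix_take // !prefixE.
rewrite [take k (take _ _)]take_takel; last exact: leq_addl.
rewrite -/(occurs_at v w i.+1) size_takel // take_takel ?leq_pred //.
have -> : behead (take (i.+1 + k).-1 w) = take (i + k).-1 (behead w).
  have -> : (i.+1 + k).-1 = ((i + k).-1).+1 by lia.
  by case: (w).
have -> : (k < i.+1 + k)%N by lia.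
case: (boolP (occurs_at v w i.+1)) => [occ|_]; last by rewrite !andbF muln0.
rewrite (L_cut occ) mulnb.
by case: (L (take _ _)); case: (L (drop _ _)); case: (_ == v); case: (infix _ _).
Qed.

Lemma starting_decomp n :
  count_words starting (n + k) = (count_words no_return (n + k) +
    \sum_(i < n.+1) count_words first_return (i + k) *
                    count_words starting (n - i + k))%N.
Proof.
rewrite -(count_words_decomp (S := fun w => starting w && infix v (behead w))).
- rewrite !count_wordsE -big_split /=; apply: eq_bigr => w _.
  by rewrite /no_return; case: (starting w) (infix v _) => [] [].
- by move=> p /and4P[].
- by move=> q /andP[].
by move=> w; exact: starting_decomp_word.
Qed.

Lemma avoiding_factor p w s : avoiding (p ++ w ++ s) -> avoiding w.
Proof.
move=> /andP[/L_factor Lw nv]; rewrite /avoiding Lw; apply: contra nv => iv.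
by apply: (infix_trans iv); apply/infixP; exists p, s.
Qed.

Lemma count_factor_submult P m n : (forall p w s, P (p ++ w ++ s) -> P w) ->
  (count_words P (m + n) <= count_words P m * count_words P n)%N.
Proof.
move=> Pf; apply: count_words_cat => w _ Pw; apply/andP; split.
  by apply: (Pf [::] _ (drop m w)); rewrite cat_take_drop.
by apply: (Pf (take m w) _ [::]); rewrite cats0 cat_take_drop.
Qed.

(** Deleting one end letter leaves a word avoiding [v]. *)
Lemma first_hit_le m : (count_words first_hit m.+1 <= count_words avoiding m * #|A|)%N.
Proof.
rewrite -[#|A|]expn1 -count_words_predT -addn1.
apply: count_words_cat => w sw /and3P[Lw _ nv].
rewrite andbT /avoiding; rewrite sw addn1 /= in nv; rewrite nv andbT.
by apply: (@L_factor [::] _ (drop m w)); rewrite cat_take_drop.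
Qed.

Lemma no_return_le m : (count_words no_return m.+1 <= #|A| * count_words avoiding m)%N.
Proof.
rewrite -[#|A|]expn1 -count_words_predT -add1n; apply: count_words_cat => w sw /=.
rewrite drop1 => /andP[/andP[Lw _] nv]; rewrite /avoiding nv andbT.
by apply: (@L_factor (take 1 w) _ [::]); rewrite cats0 -drop1 cat_take_drop.
Qed.

Definition returns_after n := exists w, [/\ size w = (n + k)%N, starting w & suffix v w].

Lemma first_return_step n : (0 < n)%N -> returns_after n ->
  exists j, [/\ (0 < j <= n)%N, (0 < count_words first_return (j + k))%N &
                returns_after (n - j)].
Proof.
move=> n0 [w [sw Sw vw]].
have iv : infix v (behead w).
  have /suffixP[[|a u] wE] := vw; first by move: sw; rewrite wE /=; lia.
  by rewrite wE /=; apply/infixP; exists u, [::]; rewrite cats0.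
have := starting_decomp_word sw; rewrite Sw iv /=.
case: (pickP (fun i : 'I_n.+1 => first_return (take (i + k) w) && starting (drop i w))).
  move=> i /andP[ri si] _.
  have iw : (i + k <= size w)%N by rewrite sw leq_add2r -ltnS.
  exists i; split.
  - have /and4P[_ _ + _] := ri; rewrite size_takel // -{1}(add0n k) ltn_add2r => ->.
    by rewrite -ltnS /=.
  - by have := count_words_gt0 ri; rewrite size_takel.
  - exists (drop i w); split => //; first by rewrite size_drop sw; have := ltn_ord i; lia.
    move: vw; rewrite !suffixE size_drop drop_drop sw.
    by have -> : (n + k - i - k + i = n + k - k)%N by have := ltn_ord i; lia.
by move=> none; rewrite big1 // => i _; rewrite none.
Qed.

End Counting.

(** * Languages and compactness *)

Section Language.
Context {A : alphabetType}.
Implicit Types (X Y : set (fullshift A)) (x : fullshift A) (w s : seq A).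

Definition window x (i : int) (n : nat) : seq A :=
  mkseq (fun j => x (i + j%:Z) : A) n.

Lemma size_window x i n : size (window x i n) = n.
Proof. exact: size_mkseq. Qed.

Lemma wordE x i n : word x i n = window x i n :> seq A.
Proof.
apply: (@eq_from_nth _ point); rewrite ?size_tuple ?size_window // => j jn.
rewrite nth_mkseq // -[j]/(nat_of_ord (Ordinal jn)) -tnth_nth tnth_mktuple //.
Qed.

Lemma window_cat x i m n :
  window x i (m + n) = window x i m ++ window x (i + m%:Z) n.
Proof.
rewrite /window /mkseq iotaD map_cat add0n; congr (_ ++ _).
rewrite -{1}(addn0 m) iotaDl -map_comp; apply: eq_map => j /=.
by rewrite PoszD addrA.
Qed.

Lemma window_cons x i n : window x i n.+1 = x i :: window x (i + 1) n.
Proof. by rewrite -add1n window_cat /window /mkseq /= addr0. Qed.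

Lemma window_shift x m i n : window (shift m x) i n = window x (i + m) n.
Proof. by apply: eq_map => j /=; rewrite /shift addrAC. Qed.

Lemma open_cylinder i w : open [set x : fullshift A | window x i (size w) = w].
Proof.
elim: w i => [|a w IH] i.
  by rewrite (_ : [set _ | _] = setT) ?predeqE //; exact: openT.
have -> : [set x : fullshift A | window x i (size (a :: w)) = a :: w] =
    [set x : fullshift A | x i = a] `&`
    [set x : fullshift A | window x (i + 1) (size w) = w].
  rewrite predeqE => x /=; rewrite window_cons.
  by split=> [[-> ->]|[-> ->]].
apply: openI => //.
have cont : continuous ((fun x => x i) : fullshift A -> discrete_topology A).
  exact: (@proj_continuous int (fun=> discrete_topology A) i).
exact: ((continuousP _).1 cont [set a] (discrete_open _)).
Qed.

Lemma fullshift_compact : compact [set: fullshift A].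
Proof.
have fA : finite_set [set: discrete_topology A] := @finite_finset A setT.
have := @tychonoff int (fun=> discrete_topology A) _ (fun=> finite_compact fA).
by congr (compact _); rewrite eqEsubset.
Qed.

(** Unlike [language], this accepts the empty word, and so is closed under
    factors. *)
Definition in_language X : pred (seq A) :=
  fun w => `[< exists x i, X x /\ window x i (size w) = w >].

Lemma in_languageP X w :
  reflect (exists x i, X x /\ window x i (size w) = w) (in_language X w).
Proof. exact: asboolP. Qed.

Lemma card_words_of_length X n :
  #|words_of_length X n| = count_words (in_language X) n.
Proof.
apply: eq_card => w; rewrite !inE; apply: asbool_equiv_eq.
split=> -[x [i [Xx xw]]]; exists x, i; split => //.
  by rewrite size_tuple -xw wordE.
by apply: val_inj; rewrite /= wordE -[RHS]xw size_tuple.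
Qed.

Lemma languageE X w : language X w <-> (0 < size w)%N /\ in_language X w.
Proof.
rewrite /language /= inE; split=> -[-> /asboolP[x [i [Xx xw]]]]; split => //; apply/asboolP.
  by exists x, i; split => //; have := congr1 val xw; rewrite /= wordE.
by exists x, i; split => //; apply: val_inj; rewrite /= wordE.
Qed.

Lemma in_language_factor X p w s : in_language X (p ++ w ++ s) -> in_language X w.
Proof.
move=> /in_languageP[x [i [Xx]]]; rewrite !size_cat !window_cat => /eqP.
rewrite eqseq_cat ?size_window // => /andP[_].
rewrite eqseq_cat ?size_window // => /andP[/eqP e _].
by apply/in_languageP; exists x, (i + (size p)%:Z).
Qed.

Lemma count_in_language_gt0 X n : X !=set0 -> (0 < count_words (in_language X) n)%N.
Proof.
move=> [x Xx]; rewrite -[n in count_words _ n](size_window x 0).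
by apply: count_words_gt0; apply/in_languageP; exists x, 0; rewrite size_window.
Qed.

Definition omitting X (v : seq A) : set (fullshift A) :=
  [set x | X x /\ forall i, window x i (size v) <> v].

Lemma omitting_subshift X v : subshift X -> omitting X v !=set0 ->
  subshift (omitting X v).
Proof.
move=> [_ clX shX] Y0; split => //.
  have -> : omitting X v =
      X `&` \bigcap_(i in [set: int]) ~` [set x | window x i (size v) = v].
    rewrite predeqE => x; split=> [[Xx nv]|[Xx nv]]; split => // i; first by move=> _; exact: nv.
    exact: nv i I.
  apply: closedI => //; apply: closed_bigI => i _.
  exact: open_closedC (open_cylinder i v).
move=> n _ [x [Xx nv] <-]; split; first by apply: (shX n); exists x.
by move=> i; rewrite window_shift.
Qed.

(** A sequential form of compactness: every finite window of [y] is seen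
    infinitely often along the sequence. *)
Lemma limit_point X (x : nat -> fullshift A) : closed X -> (forall N, X (x N)) ->
  exists y, X y /\ forall i n M, exists N, (M <= N)%N /\ window (x N) i n = window y i n.
Proof.
move=> clX Xx.
have cX : compact X by apply: (subclosed_compact clX fullshift_compact).
have FX : (x N @[N --> \oo]) X by exists 0%N => // N _; exact: Xx.
have [y [Xy cy]] := cX _ _ FX.
exists y; split => // i n M.
have nb : nbhs y [set z : fullshift A | window z i n = window y i n].
  have := open_cylinder i (window y i n); rewrite size_window => op.
  exact: open_nbhs_nbhs.
have FM : (x N @[N --> \oo]) [set x N | N in [set N | (M <= N)%N]].
  by exists M => // N MN; exists N.
by have [_ [[N MN <-] e]] := cy _ _ FM nb; exists N.
Qed.

Section Padded.
Variables (X : set (fullshift A)) (v : seq A).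
Local Notation L := (in_language X).
Local Notation Y := (omitting X v).

(** Words that still avoid [v] in [X] after some extension by [N] letters on both
    sides; as [N] grows these approximate the words of [omitting X v]. *)
Definition padded (N : nat) : pred (seq A) := fun w =>
  `[< exists p s, [/\ size p = N, size s = N & avoiding L v (p ++ w ++ s)] >].

Lemma avoiding_L_factor p w s : avoiding L v (p ++ w ++ s) -> avoiding L v w.
Proof. by apply: avoiding_factor; exact: in_language_factor. Qed.

Lemma padded_trim N p w s : (N <= size p)%N -> (N <= size s)%N ->
  avoiding L v (p ++ w ++ s) -> padded N w.
Proof.
move=> Np Ns av; apply/asboolP; exists (drop (size p - N) p), (take N s); split.
- by rewrite size_drop subKn.
- by rewrite size_takel.
apply: (@avoiding_L_factor (take (size p - N) p) _ (drop N s)).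
by rewrite -!catA cat_take_drop catA cat_take_drop.
Qed.

Lemma padded_factor N p w s : padded N (p ++ w ++ s) -> padded N w.
Proof.
move=> /asboolP[p' [s' [sp ss av]]].
apply: (@padded_trim N (p' ++ p) w (s ++ s')); rewrite ?size_cat.
- by rewrite sp leq_addr.
- by rewrite ss leq_addl.
by rewrite -!catA; move: av; rewrite -!catA.
Qed.

Lemma padded_le N M w : (N <= M)%N -> padded M w -> padded N w.
Proof.
move=> NM /asboolP[p [s [sp ss av]]].
by apply: (padded_trim _ _ av); rewrite ?sp ?ss.
Qed.

(** A limit point of points of [X] whose central windows, of growing length, are
    extensions of [w] avoiding [v] contains [w] and avoids [v] everywhere. *)
Lemma padded_limit w : subshift X -> (forall N, padded N w) -> in_language Y w.
Proof.
move=> [_ clX shX] pw.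
have centred N : exists x, [/\ X x, window x 0 (size w) = w &
    avoiding L v (window x (- N%:Z) (N + (size w + N)))].
  have /asboolP[p [s [sp ss /[dup] av /andP[/in_languageP[x [i [Xx xe]]] _]]]] := pw N.
  exists (shift (i + N%:Z) x); split.
  - by apply: shX; exists x.
  - move: xe; rewrite window_shift add0r !size_cat !window_cat sp => /eqP.
    rewrite eqseq_cat ?size_window // => /andP[_].
    by rewrite eqseq_cat ?size_window // => /andP[/eqP].
  - rewrite window_shift addrCA addNr addr0.
    have -> : (N + (size w + N))%N = size (p ++ w ++ s) by rewrite !size_cat sp ss.
    by rewrite xe.
have [x Hx] := choice centred.
have Xx N : X (x N) by have [] := Hx N.
have [y [Xy ylim]] := limit_point clX Xx.
have yw : window y 0 (size w) = w.
  by have [N [_ <-]] := ylim 0 (size w) 0%N; have [] := Hx N.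
apply/in_languageP; exists y, 0; split => //; split => // i vi.
have [N [MN yN]] := ylim i (size v) (`|i| + size v)%N.
have [_ _ /andP[_ /negP]] := Hx N; apply; rewrite -vi -yN.
(* The occurrence of [v] at [i] lies inside the central window of [x N]. *)
have ge0 : 0 <= i + N%:Z by lia.
have aE : (absz (i + N%:Z))%:Z = i + N%:Z by lia.
set a := absz _ in aE.
have -> : (N + (size w + N) = a + (size v + (N + (size w + N) - a - size v)))%N.
  by lia.
rewrite !window_cat; apply/infixP; do 2!eexists.
congr (_ ++ (_ ++ _)).
by congr (window _ _ _); lia.
Qed.

Lemma padded_uniform m : subshift X -> exists N, forall M, (N <= M)%N ->
  forall w, size w = m -> padded M w -> in_language Y w.
Proof.
move=> subX.
have H (w : m.-tuple A) : exists N, padded N w -> in_language Y w.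
  have [nw|nw] := pselect (exists N, ~ padded N w).
    by have [N Nw] := nw; exists N.
  exists 0%N => _; apply: padded_limit => // N.
  by apply: contrapT => nN; apply: nw; exists N.
have [f Hf] := choice H.
exists (\max_(w : m.-tuple A) f w)%N => M NM w sw pw.
have sw' : size w == m by apply/eqP.
apply: (Hf (Tuple sw')); apply: (padded_le _ pw).
by apply: leq_trans NM; exact: leq_bigmax.
Qed.

Lemma avoiding_padded_le N n : (count_words (avoiding L v) (N + (n + N)) <=
  #|A| ^ N * (count_words (padded N) n * #|A| ^ N))%N.
Proof.
pose P : pred (seq A) := fun w =>
  `[< exists p s, [/\ size p = N, size s = N & avoiding L v (p ++ take n w ++ s)] >].
apply: (@leq_trans (#|A| ^ N * count_words P (n + N))).
  rewrite -count_words_predT; apply: count_words_cat => w sw av /=.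
  apply/asboolP; exists (take N w), (drop n (drop N w)); split.
  - by rewrite size_takel // sw leq_addr.
  - by rewrite !size_drop sw; lia.
  - by rewrite !cat_take_drop.
rewrite leq_mul2l; apply/orP; right.
by rewrite -count_words_predT; apply: count_words_cat => w sw Pw; rewrite andbT.
Qed.

(** If the words avoiding [v] had growth rate [h] then, for each [m], so would
    the padded words, which for large padding factor into words of length [m] of
    [omitting X v].  That language would have at least [e^(h m)] words of every
    length [m], against entropy minimality.  An empty [omitting X v] is covered
    too: it has no word at all. *)
Lemma avoiding_subcritical (R : realType) : subshift X -> (0 < size v)%N -> L v ->
  entropy_minimal R X ->
  exists2 M, (0 < M)%N &
    (count_words (avoiding L v) M)%:R < expR (htop R X * M%:R).
Proof.
move=> subX v0 Lv minX; apply: contrapT => none.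
set h := htop R X in none.
have big M : expR (h * M.+1%:R) <= (count_words (avoiding L v) M.+1)%:R.
  by rewrite leNgt; apply/negP => lt; apply: none; exists M.+1.
have bigY m : expR (h * m%:R) <= (count_words (in_language Y) m)%:R :> R.
  have [N0 HN] := padded_uniform m subX.
  (* [N > 0] keeps the length below positive, as [big] requires. *)
  pose N := N0.+1.
  pose C : R := #|A|%:R ^+ N * #|A|%:R ^+ N * expR (- (h * (N + N)%:R)).
  apply: (@le_of_pow_le _ _ _ C) => // q.
  have pc : (count_words (padded N) (q * m) <= count_words (in_language Y) m ^ q)%N.
    elim: q => [|q IH].
      rewrite mul0n expn0 /count_words; apply: leq_trans (max_card _) _.
      by rewrite card_tuple expn0.
    rewrite mulSn expnS; apply: leq_trans (count_factor_submult _ _ (@padded_factor N)) _.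
    apply: leq_mul => //; apply: count_words_le => w.
    by apply: HN; exact: leqnSn.
  have := big (N0 + (q * m + N))%N; rewrite -addSn -/N => le1.
  have le2 : (count_words (avoiding L v) (N + (q * m + N)))%:R <=
     #|A|%:R ^+ N * #|A|%:R ^+ N * (count_words (in_language Y) m)%:R ^+ q :> R.
    rewrite -!natrX -!natrM ler_nat; apply: leq_trans (avoiding_padded_le _ _) _.
    by rewrite -mulnA leq_mul // [X in (X <= _)%N]mulnC leq_mul.
  have := le_trans le1 le2.
  have -> : h * (N + (q * m + N))%:R = h * m%:R * q%:R + h * (N + N)%:R.
    by rewrite !natrD natrM; ring.
  by rewrite expRD expRM_natr /C expRN => H; rewrite mulrAC ler_pdivlMr ?expR_gt0.
have Y0 : Y !=set0.
  have : (0 < count_words (in_language Y) 1)%N.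
    by rewrite -(ltr_nat R); apply: lt_le_trans (bigY 1%N); exact: expR_gt0.
  rewrite card_gt0 => /set0Pn[w]; rewrite inE => /in_languageP[x [i [Yx _]]].
  by exists x.
have subY := omitting_subshift subX Y0.
have YX : Y `<` X.
  split; first by move=> x [].
  move=> XY; have /in_languageP[x [i [Xx xv]]] := Lv.
  by have [_ /(_ i)] := XY _ Xx.
have := minX Y subY YX; rewrite ltNge => /negP; apply.
rewrite -/h /htop; apply: limr_ge.
  under eq_fun do rewrite card_words_of_length.
  apply: fekete_cvg => [n|m n]; first by rewrite ler1n count_in_language_gt0.
  rewrite -natrM ler_nat; apply: count_factor_submult.
  by move=> p w s; exact: in_language_factor.
exists 1%N => // n /= n0; rewrite card_words_of_length.
rewrite ler_pdivlMl ?ltr0n // mulrC -[leLHS]expRK ler_ln ?posrE ?expR_gt0 //.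
by rewrite ltr0n count_in_language_gt0.
Qed.

End Padded.

(** * The measure of maximal entropy *)

Lemma measurable_cylinder i w :
  measurable [set x : fullshift A | window x i (size w) = w].
Proof. by apply: sub_sigma_algebra; exact: open_cylinder. Qed.

Lemma measurable_closed X : closed X -> measurable X.
Proof.
move=> clX; rewrite -[X]setCK; apply: measurableC.
by apply: sub_sigma_algebra; exact: closed_openC.
Qed.

(** Gibbs' inequality against the uniform distribution on [S]. *)
Lemma entropy_le_ln_card (R : realType) (I : finType) (p : I -> R) (S : {set I}) :
  (forall i, 0 <= p i) -> \sum_i p i = 1 -> (forall i, i \notin S -> p i = 0) ->
  (0 < #|S|)%N /\ \sum_i - (p i * ln (p i)) <= ln (#|S|%:R : R).
Proof.
move=> p0 p1 pS.
have S0 : (0 < #|S|)%N.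
  rewrite lt0n; apply/negP => /eqP/cards0_eq S0.
  move: p1; rewrite big1 => [/eqP|i _]; first by rewrite eq_sym oner_eq0.
  by rewrite pS // S0 inE.
split => //; set D : R := #|S|%:R.
have D0 : 0 < D by rewrite ltr0n.
have bound i : - (p i * ln (p i)) <= p i * ln D + ((i \in S)%:R / D - p i).
  have [pi0|] := eqVneq (p i) 0.
    by rewrite pi0 !mul0r oppr0 add0r addr0 divr_ge0 ?ler0n // ltW.
  move=> pn0; have pp : 0 < p i by rewrite lt0r pn0 p0.
  have -> : i \in S by apply: contraNT pn0 => /pS ->.
  have pD : 0 < p i * D by rewrite mulr_gt0.
  have -> : - (p i * ln (p i)) = p i * ln D + p i * ln (p i * D)^-1.
    by rewrite lnV ?posrE // lnM ?posrE //; ring.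
  rewrite lerD2l mul1r.
  have -> : D^-1 - p i = p i * ((p i * D)^-1 - 1).
    by field; rewrite !gt_eqF.
  rewrite ler_pM2l //; have := @le_ln1Dx R ((p i * D)^-1 - 1).
  by rewrite subrKC; apply; rewrite ltrBrDl subrr invr_gt0.
apply: le_trans (ler_sum _ (fun i _ => bound i)) _.
rewrite big_split /= sumrB -mulr_suml p1 mul1r -mulr_suml -natr_sum.
have -> : (\sum_i (i \in S) = #|S|)%N.
  by rewrite -sum1_card [RHS]big_mkcond /=; apply: eq_bigr => i _; case: (i \in S).
by rewrite divff ?gt_eqF // subrr addr0.
Qed.

Section MeasureOfMaximalEntropy.
Variables (R : realType) (X : set (fullshift A)) (mu : probability (fullshift A) R).
Hypothesis X_subshift : subshift X.
Hypothesis mu_inv : invariant_measure_on X mu.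

Let X_closed : closed X. Proof. by case: X_subshift. Qed.

Lemma word_set_measurable n (w : n.-tuple A) :
  measurable [set x | X x /\ word x 0 n = w].
Proof.
have -> : [set x | X x /\ word x 0 n = w] = X `&` [set x | window x 0 (size w) = w].
  rewrite predeqE => x; split=> -[Xx xw]; split => //=.
    by rewrite -xw wordE size_tuple.
  by apply: val_inj; rewrite /= wordE -[RHS]xw size_tuple.
by apply: measurableI; [exact: measurable_closed|exact: measurable_cylinder].
Qed.

Lemma word_measure_ge0 n (w : n.-tuple A) : 0 <= word_measure X mu w.
Proof. by apply: fine_ge0; exact: measure_ge0. Qed.

Lemma sum_word_measure n : \sum_(w : n.-tuple A) word_measure X mu w = 1.
Proof.
apply: EFin_inj; rewrite -sumEFin -[RHS](mu_inv.1).
have wmE (w : n.-tuple A) :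
    (word_measure X mu w)%:E = mu [set x | X x /\ word x 0 n = w].
  by rewrite fineK // fin_num_measure //; exact: word_set_measurable.
under eq_bigr => w _ do rewrite wmE.
have XE : X = \bigcup_(w in [set: n.-tuple A]) [set x | X x /\ word x 0 n = w].
  rewrite predeqE => x; split=> [Xx|[w _ [] //]].
  by exists (word x 0 n).
rewrite [in RHS]XE measure_fin_bigcup //.
- rewrite (fsbigE (index_enum (n.-tuple A))) ?index_enum_uniq //.
    by apply: eq_bigl => w; rewrite mem_set.
  by move=> w _; rewrite mem_index_enum.
- exact: finite_finset.
- by move=> w w' _ _ [x [[_ <-] [_ <-]]].
- by move=> w _; exact: word_set_measurable.
Qed.

Lemma word_measure_supp (v : seq A) n (w : n.-tuple A) :
  mu [set x | window x 0 (size v) = v] = 0%E ->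
  ~~ avoiding (in_language X) v w -> word_measure X mu w = 0.
Proof.
move=> v0; rewrite negb_and negbK => /orP[nw|/infixP[p [s wE]]].
  rewrite /word_measure (_ : [set x | _] = set0) ?measure0 // predeqE => x.
  split=> // -[Xx xw]; move/negP: nw; apply; apply/in_languageP; exists x, 0.
  by split => //; rewrite size_tuple -xw wordE.
rewrite /word_measure (@subset_measure0 _ _ _ _ _
  (shift (size p)%:Z @^-1` [set x | window x 0 (size v) = v])) //.
- exact: word_set_measurable.
- have -> : shift (size p)%:Z @^-1` [set x | window x 0 (size v) = v] =
      [set x | window x (size p)%:Z (size v) = v].
    by rewrite predeqE => x /=; rewrite window_shift add0r.
  exact: measurable_cylinder.
- move=> x /= [Xx xw]; rewrite window_shift.
  have := wordE x 0 n; rewrite xw wE => /esym.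
  have -> : n = (size p + (size v + size s))%N.
    by rewrite -(size_tuple w) wE !size_cat.
  rewrite !window_cat => /eqP; rewrite eqseq_cat ?size_window // => /andP[_].
  by rewrite eqseq_cat ?size_window // => /andP[/eqP].
- exact: etrans (mu_inv.2 _ _ (measurable_cylinder 0 v)) v0.
Qed.

(** If [v] had measure zero, only words avoiding [v] would be charged, and the
    entropy of [mu] would be at most [ln d_M / M < h] along the multiples of [M]. *)
Lemma sync_word_measure_gt0 (v : seq A) M :
  measure_entropy X mu = htop R X -> (0 < M)%N ->
  (count_words (avoiding (in_language X) v) M)%:R < expR (htop R X * M%:R) ->
  (0 < mu [set x | window x 0 (size v) = v])%E.
Proof.
move=> hmax M0 sub; rewrite lt_neqAle measure_ge0 andbT eq_sym.
apply/negP => /eqP v0.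
set L := in_language X in sub; set h := htop R X in hmax sub.
pose c n := count_words (avoiding L v) n.
pose H n := \sum_(w : n.-tuple A) - (word_measure X mu w * ln (word_measure X mu w)).
have bound n : (0 < c n)%N /\ H n <= ln (c n)%:R.
  apply: entropy_le_ln_card.
  - exact: word_measure_ge0.
  - exact: sum_word_measure.
  - by move=> w; rewrite inE; exact: word_measure_supp.
have cq q : (c (q * M) <= c M ^ q)%N.
  elim: q => [|q IH].
    by rewrite mul0n expn0 /c; apply: leq_trans (max_card _) _; rewrite card_tuple expn0.
  rewrite mulSn expnS; apply: leq_trans (count_factor_submult _ _ _) _.
    by move=> p w s; exact: avoiding_L_factor.
  by rewrite leq_mul2l IH orbT.
have cM : 0 < (c M)%:R :> R by rewrite ltr0n; have [] := bound M.
have MR : 0 < M%:R :> R by rewrite ltr0n.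
pose l := ln (c M)%:R / M%:R : R.
have lh : l < h.
  by rewrite ltr_pdivrMr // -[ltRHS]expRK ltr_ln ?posrE ?expR_gt0.
have Hl q : (q.+1 * M)%N%:R^-1 * H (q.+1 * M)%N <= l.
  rewrite /l ler_pdivlMr // natrM.
  have -> : (q.+1%:R * M%:R)^-1 * H (q.+1 * M)%N * M%:R = H (q.+1 * M)%N / q.+1%:R :> R.
    by field; rewrite !gt_eqF // ltr0n.
  rewrite ler_pdivrMr ?ltr0n // mulr_natr -lnXn //.
  apply: le_trans (bound _).2 _; rewrite ler_ln ?posrE ?exprn_gt0 ?ltr0n ?(bound _).1 //.
  by rewrite -natrX ler_nat.
suff : h <= l by rewrite leNgt lh.
have [cv|ncv] := pselect (cvgn (fun n => n%:R^-1 * H n)).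
  have : (fun q => (q.+1 * M)%N%:R^-1 * H (q.+1 * M)%N) q @[q --> \oo] --> h.
    rewrite -hmax.
    have oo : (fun q => q.+1 * M)%N q @[q --> \oo] --> \oo.
      by apply/cvgnyPge => B; exists B => // q /= Bq; nia.
    exact: (cvg_comp _ _ oo cv).
  move=> cvq; rewrite -(cvg_lim _ cvq) //; apply: limr_le.
    by apply/cvg_ex; exists h.
  exact: nearW.
(* If the averages diverge, [limn] takes its default value 0, so [h = 0]. *)
have -> : h = 0 by rewrite -hmax; exact: dvgP ncv.
by rewrite divr_ge0 ?ler0n // ln_ge0 // ler1n; have [] := bound M.
Qed.

Lemma mixing_returns (v : seq A) : mixing mu ->
  (0 < mu [set x | window x 0 (size v) = v])%E ->
  exists N, forall n, (N <= n)%N -> returns_after (in_language X) v n.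
Proof.
move=> mix; set C := [set x | _] => C0.
have mC : measurable C by exact: measurable_cylinder.
have shE n : shift (- n%:Z) @` C = [set x | window x n%:Z (size v) = v].
  rewrite predeqE => x; split=> [[y Cy <-]|xv] /=.
    by rewrite window_shift subrr.
  exists (shift n%:Z x); first by rewrite /C /= window_shift add0r.
  by apply: funext => i; rewrite /shift addrNK.
have := mix C C mC mC.
have muC : mu C = (fine (mu C))%:E by rewrite fineK // fin_num_measure.
rewrite muC -EFinM => /fine_cvgP[_ cv].
have C0' : 0 < fine (mu C) by move: C0; rewrite muC lte_fin.
have [N _ HN] : \forall n \near \oo, 0 < fine (mu (C `&` shift (- n%:Z) @` C)).
  by apply: (cvgr_gt _ cv); rewrite mulr_gt0.
exists N => n Nn; have := HN n Nn; rewrite shE => pos.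
have [x [[xv xnv] Xx]] : C `&` [set x | window x n%:Z (size v) = v] `&` X !=set0.
  apply/set0P/negP => /eqP dis.
  suff e : mu (C `&` [set x | window x n%:Z (size v) = v]) = 0%E.
    by move: pos; rewrite e ltxx.
  apply: (@subset_measure0 _ _ _ _ _ (~` X)).
  - by apply: measurableI => //; exact: measurable_cylinder.
  - by apply: measurableC; exact: measurable_closed.
  - by apply/disjoints_subset.
  - apply: etrans (probability_setC mu (measurable_closed X_closed)) _.
    by rewrite mu_inv.1 subee.
exists (window x 0 (n + size v)%N); split; first by rewrite size_window.
  apply/andP; split; first by apply/in_languageP; exists x, 0; rewrite size_window.
  by apply/prefixP; exists (window x (size v)%:Z n); rewrite addnC window_cat add0r xv.
by apply/suffixP; exists (window x 0 n); rewrite window_cat add0r xnv.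
Qed.

End MeasureOfMaximalEntropy.

End Language.

(** * Convergence of the normalized counts *)

Section Counts.
Variables (R : realType) (A : alphabetType) (X : set (fullshift A)) (v : seq A).
Hypothesis X_subshift : subshift X.
Hypothesis X_min : entropy_minimal R X.
Hypothesis v_sync : synchronizing X v.
Local Notation L := (in_language X).
Local Notation k := (size v).
Local Notation h := (htop R X).

Definition normalized_count (P : pred (seq A)) (n : nat) : R :=
  (count_words P n)%:R * expR (- (h * n%:R)).

Lemma normalized_count_ge0 P n : 0 <= normalized_count P n.
Proof. by rewrite mulr_ge0 ?expR_ge0 ?ler0n. Qed.

Lemma v_size_gt0 : (0 < k)%N. Proof. by have [/languageE[]] := v_sync. Qed.
Lemma v_in_language : L v. Proof. by have [/languageE[]] := v_sync. Qed.

Lemma in_language_sync u w : L (u ++ v) -> L (v ++ w) -> L (u ++ v ++ w).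
Proof.
move=> Lu Lw; have [_ H] := v_sync; apply: (proj2 ((languageE _ _).1 _)).
by apply: H; apply/languageE; split => //; rewrite size_cat ?addn_gt0 v_size_gt0 ?orbT.
Qed.

Lemma avoiding_summable : cvgn (series (normalized_count (avoiding L v))).
Proof.
have [M M0 sub] := avoiding_subcritical X_subshift v_size_gt0 v_in_language X_min.
apply: (@submult_summable _ _ M).
- exact: normalized_count_ge0.
- move=> m n; rewrite /normalized_count natrD mulrDr opprD expRD.
  rewrite mulrACA ler_wpM2r ?mulr_ge0 ?expR_ge0 // -natrM ler_nat.
  by apply: count_factor_submult => p w s; exact: avoiding_L_factor.
- by rewrite /normalized_count expRN ltr_pdivrMr ?expR_gt0 // mul1r.
Qed.

Lemma summable_of_avoiding P (c : nat) :
  (forall m, (count_words P m.+1 <= c * count_words (avoiding L v) m)%N) ->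
  cvgn (series (fun n => normalized_count P (n + k))).
Proof.
move=> le; have sumd := avoiding_summable.
pose K : R := c%:R * expR (- h); set d := normalized_count (avoiding L v) in sumd *.
have K0 : 0 <= K by rewrite mulr_ge0 ?expR_ge0 ?ler0n.
have d0 i : 0 <= d i by exact: normalized_count_ge0.
have step m : normalized_count P m.+1 <= K * d m.
  have -> : K * d m = (c * count_words (avoiding L v) m)%N%:R * expR (- (h * m.+1%:R)).
    by rewrite natrM -[m.+1]addn1 natrD mulrDr mulr1 opprD expRD /K /d
      /normalized_count; ring.
  by rewrite ler_wpM2r ?expR_ge0 // ler_nat.
apply: (@cvg_nonneg_series _ _ (K * limn (series d))) => [i|n].
  exact: normalized_count_ge0.
apply: (@le_trans _ _ (\sum_(i < n) K * d (k.-1 + i)%N)).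
  apply: ler_sum => i _; apply: le_trans (step _).
  by rewrite -addSn prednK ?v_size_gt0 // addnC.
rewrite -mulr_sumr ler_wpM2l //.
apply: le_trans (series_le_lim (k.-1 + n) d0 sumd).
by rewrite big_split_ord /= lerDr sumr_ge0.
Qed.

Lemma language_growth c : h < c ->
  exists2 C, 0 < C & forall n, (count_words L n)%:R <= C * expR (c * n%:R).
Proof.
move=> hc; apply: submult_growth_lim.
- by move=> n; rewrite ler1n count_in_language_gt0 //; case: X_subshift.
- move=> m n; rewrite -natrM ler_nat; apply: count_factor_submult.
  by move=> p w s; exact: in_language_factor.
by under eq_fun do rewrite -card_words_of_length.
Qed.

Lemma first_return0 : count_words (first_return L v) k = 0%N.
Proof.
rewrite count_wordsE big1 // => w _.
by rewrite /first_return size_tuple ltnn !andbF.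
Qed.

Lemma starting_cvg N : (forall n, (N <= n)%N -> returns_after L v n) ->
  cvgn (fun n => normalized_count (starting L v) (n + k)).
Proof.
move=> ret.
pose w n := normalized_count (starting L v) (n + k).
pose g n := normalized_count (no_return L v) (n + k).
(* The overlap [v] is counted in both factors of a cut, so the weights are
   normalized by the return time [n] and not by the length [n + k]. *)
pose f n : R := (count_words (first_return L v) (n + k))%:R * expR (- (h * n%:R)).
have f0 i : 0 <= f i by rewrite mulr_ge0 ?expR_ge0 ?ler0n.
have f00 : f 0%N = 0 by rewrite /f add0n first_return0 mul0r.
have g0 i : 0 <= g i by exact: normalized_count_ge0.
have w0 i : 0 <= w i by exact: normalized_count_ge0.
have wE n : w n = g n + \sum_(i < n.+1) f i * w (n - i)%N.
  rewrite /w /g /normalized_count.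
  rewrite (starting_decomp v_size_gt0 (@in_language_factor _ X) in_language_sync).
  rewrite natrD mulrDl; congr (_ + _); rewrite natr_sum mulr_suml.
  apply: eq_bigr => i _; rewrite natrM /f.
  have -> : (n + k)%:R = i%:R + (n - i + k)%:R :> R.
    by rewrite -natrD addnA subnKC // -ltnS.
  by rewrite mulrDr opprD expRD mulrACA.
have cg : cvgn (series g).
  apply: summable_of_avoiding => m.
  exact: (no_return_le v (@in_language_factor _ X)).
have w00 : 0 < w 0%N.
  rewrite /w /normalized_count add0n mulr_gt0 ?expR_gt0 // ltr0n.
  by apply: count_words_gt0; rewrite /starting v_in_language prefix_refl.
have wsub e : 0 < e -> exists2 C, 0 < C & forall n, w n <= C * expR (e * n%:R).
  move=> e0; have he : h < h + e by rewrite ltrDl.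
  have [C C0 HC] := language_growth he.
  exists (C * expR (e * k%:R)); first by rewrite mulr_gt0 ?expR_gt0.
  move=> n; rewrite /w /normalized_count expRN ler_pdivrMr ?expR_gt0 //.
  have -> : C * expR (e * k%:R) * expR (e * n%:R) * expR (h * (n + k)%:R) =
      C * expR ((h + e) * (n + k)%:R).
    rewrite -!mulrA; congr (_ * _); rewrite -!expRD; congr expR.
    by rewrite natrD; ring.
  apply: le_trans (HC _); rewrite ler_nat; apply: count_words_le.
  by move=> ? _ /andP[].
apply: (renewal_cvg f0 f00 _ g0 cg wE ret).
  exact: (renewal_mass_le1 f0 g0 f00 w0 w00 wE wsub).
move=> n n0 /(first_return_step v_size_gt0 (@in_language_factor _ X) in_language_sync n0).
move=> [j [jn rj Dj]]; exists j; split => //.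
by rewrite mulr_gt0 ?expR_gt0 // ltr0n.
Qed.

Lemma language_cvg : cvgn (fun n => normalized_count (starting L v) (n + k)) ->
  cvgn (fun n => normalized_count L n).
Proof.
move=> cw.
pose w n := normalized_count (starting L v) (n + k).
pose a n : R := (count_words (first_hit L v) (n + k))%:R * expR (- (h * n%:R)).
have a0 i : 0 <= a i by rewrite mulr_ge0 ?expR_ge0 ?ler0n.
have ca : cvgn (series a).
  have := summable_of_avoiding (P := first_hit L v) (c := #|A|) _.
  have aE : a = (expR (h * k%:R) *: (fun n => normalized_count (first_hit L v) (n + k)
      : R^o)).
    apply: funext => n; rewrite /a /normalized_count /GRing.scale /=.
    rewrite -[RHS]/(_ * _) mulrCA -expRD; congr (_ * expR _).
    by rewrite natrD; ring.
  rewrite aE => H; apply: is_cvg_seriesZ; apply: H => m.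
  by rewrite mulnC; exact: (first_hit_le v (@in_language_factor _ X)).
have d0 : normalized_count (avoiding L v) (n + k) @[n --> \oo] --> 0.
  have := cvg_series_cvg_0 avoiding_summable.
  by rewrite -(cvg_shiftn k).
have [B [_ HB]] := cvg_seq_bounded cw.
have wB n : `|w n| <= B + 1 by apply: HB => //; rewrite ltrDl.
have conv := convolution_cvg a0 ca wB cw.
apply/cvg_ex; exists (0 + limn (series a) * limn w); rewrite -(cvg_shiftn k).
have -> : [sequence normalized_count L (n + k)]_n =
    (fun n => normalized_count (avoiding L v) (n + k) +
              \sum_(i < n.+1) a i * w (n - i)%N).
  apply: funext => n; rewrite /mk_sequence /normalized_count.
  rewrite (language_decomp v_size_gt0 (@in_language_factor _ X) in_language_sync).
  rewrite natrD mulrDl; congr (_ + _); rewrite natr_sum mulr_suml.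
  apply: eq_bigr => i _; rewrite natrM /a.
  have -> : (n + k)%:R = i%:R + (n - i + k)%:R :> R.
    by rewrite -natrD addnA subnKC // -ltnS.
  by rewrite mulrDr opprD expRD mulrACA.
exact: cvgD.
Qed.

End Counts.

Theorem theorem3p18 (R : realType) (A : alphabetType) (X : set (fullshift A))
    (mu : probability (fullshift A) R)
    (X_subshift : subshift X)
    (X_sync : synchronized X)
    (X_min : entropy_minimal R X)
    (mu_max : maximal_entropy_measure X mu)
    (mu_mix : mixing mu) :
  cvgn (fun n : nat =>
    #|words_of_length X n|%:R / expR (n%:R * htop R X) : R).
Proof.
have [v v_sync] := X_sync.
have [mu_inv mu_ent] := mu_max.
have [M M0 sub] := avoiding_subcritical X_subshift (v_size_gt0 v_sync)
  (v_in_language v_sync) X_min.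
have v_pos := sync_word_measure_gt0 X_subshift mu_inv mu_ent M0 sub.
have [N ret] := mixing_returns X_subshift mu_inv mu_mix v_pos.
have -> : (fun n => #|words_of_length X n|%:R / expR (n%:R * htop R X)) =
    normalized_count R X (in_language X).
  apply: funext => n.
  by rewrite /normalized_count card_words_of_length expRN [htop R X * _]mulrC.
exact: language_cvg v_sync (starting_cvg X_subshift X_min v_sync ret).
Qed.
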